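(* Let $(\delta_0,\delta_1,\ldots,\delta_d)$ be a finite sequence of nonnegative integers with $\delta_0=1$ and $\sum_{i=0}^d\delta_i=5$. Let $i_1,\ldots,i_4$ be the positive integers such that $\sum_{i=0}^d\delta_i t^i=1+t^{i_1}+t^{i_2}+t^{i_3}+t^{i_4}$ with $1 \leq i_1 \leq i_2\leq i_3 \leq i_4 \leq d$. Then there exists an integral simplex $\mathcal{P} \subset \mathbb{R}^d$ of dimension $d$ whose $\delta$-vector coincides with $(\delta_0,\delta_1,\ldots,\delta_d)$ if and only if $$i_1+i_4=i_2+i_3 \leq d+1 \quad\text{and}\quad i_k+i_{\ell} \geq i_{k+\ell} \ \text{ for all } 1 \leq k \leq \ell \leq 4 \text{ with } k+\ell \leq 4.$$
   Context: An integral convex polytope $\mathcal{P}\subset\mathbb{R}^N$ is a convex polytope all of whose vertices have integer coordinates; an integral simplex of dimension $d$ is an integral convex polytope that is a $d$-dimensional simplex. For an integral convex polytope $\mathcal{P}$ of dimension $d$ and an integer $n\ge 1$, let $i(\mathcal{P},n)=|n\mathcal{P}\cap\mathbb{Z}^N|$, where $n\mathcal{P}=\{n\alpha:\alpha\in\mathcal{P}\}$, and $i(\mathcal{P},0)=1$; this is a polynomial in $n$ of degree $d$ (the Ehrhart polynomial). The $\delta$-vector $\delta(\mathcal{P})=(\delta_0,\delta_1,\ldots,\delta_d)$ is the integer sequence defined by $(1-\lambda)^{d+1}\sum_{n=0}^\infty i(\mathcal{P},n)\lambda^n=\sum_{i=0}^d\delta_i\lambda^i$ (it is known that the left side is a polynomial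 of degree at most $d$, that all $\delta_i$ are nonnegative integers, and that $\delta_0=1$). *)

(* Defs.v *)
From HB Require Import structures.
From mathcomp Require Import all_boot all_order all_algebra.
From mathcomp Require Import finmap.
From mathcomp Require Import all_classical all_reals.

Set Implicit Arguments.
Unset Strict Implicit.
Unset Printing Implicit Defensive.

Import Order.TTheory GRing.Theory Num.Theory.
Local Open Scope classical_set_scope.
Local Open Scope ring_scope.

Definition conv_hull (R : realType) (N m : nat) (V : 'I_m -> 'rV[R]_N) :
    set 'rV[R]_N :=
  [set x | exists w : 'I_m -> R,
    [/\ forall j, 0 <= w j, \sum_j w j = 1 & x = \sum_j w j *: V j]].

Definition convex_polytope (R : realType) (N : nat) (P : set 'rV[R]_N) : Prop :=
  exists (m : nat) (V : 'I_m -> 'rV[R]_N), P = conv_hull V.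

(* The vertices of a polytope are its extreme points. *)
Definition vertex (R : realType) (N : nat) (P : set 'rV[R]_N) (v : 'rV[R]_N) :
    Prop :=
  P v /\ forall (x y : 'rV[R]_N) (t : R),
    P x -> P y -> 0 < t < 1 -> v = t *: x + (1 - t) *: y -> x = v /\ y = v.

Definition integer_points (R : realType) (N : nat) : set 'rV[R]_N :=
  [set x | forall j, x ord0 j \is a Num.int].

Definition integral_polytope (R : realType) (N : nat) (P : set 'rV[R]_N) :
    Prop :=
  convex_polytope P /\ vertex P `<=` @integer_points R N.

Definition affinely_independent (R : realType) (N d : nat)
    (V : 'I_d.+1 -> 'rV[R]_N) : bool :=
  row_free (\matrix_(j < d) (V (lift ord0 j) - V ord0)).

Definition simplex (R : realType) (N d : nat) (P : set 'rV[R]_N) : Prop :=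
  exists V : 'I_d.+1 -> 'rV[R]_N, affinely_independent V /\ P = conv_hull V.

Definition integral_simplex (R : realType) (N d : nat) (P : set 'rV[R]_N) :
    Prop :=
  integral_polytope P /\ simplex d P.

Definition dilate (R : realType) (N n : nat) (P : set 'rV[R]_N) :
    set 'rV[R]_N :=
  [set n%:R *: x | x in P].

(* [fset_set] is empty on infinite sets; this never matters for a polytope,
   which is bounded and so has finitely many integer points in each dilate. *)
Definition ehrhart (R : realType) (N : nat) (P : set 'rV[R]_N) (n : nat) : nat :=
  if n is 0%N then 1%N
  else #|` fset_set (dilate n P `&` @integer_points R N)|%fset.

(* The formal power series \sum_n a_n lambda^n is represented by its sequence
   of coefficients a; this is its (Cauchy) product by the polynomial p. *)
Definition mul_poly_series (p : {poly int}) (a : nat -> int) (n : nat) : int :=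
  \sum_(k < n.+1) p`_k * a (n - k)%N.

Definition gen_poly (d : nat) (delta : 'I_d.+1 -> int) : {poly int} :=
  \sum_(k < d.+1) delta k *: 'X^k.

(* Meant for P of dimension d: the equality of formal power series
   (1 - lambda)^(d+1) \sum_n i(P, n) lambda^n = \sum_(k <= d) delta_k lambda^k,
   including the vanishing of all coefficients of index > d on the left. *)
Definition is_delta_vector (R : realType) (N d : nat) (P : set 'rV[R]_N)
    (delta : 'I_d.+1 -> int) : Prop :=
  forall n : nat,
    mul_poly_series ((1 - 'X) ^+ d.+1) (fun m => (ehrhart P m)%:Z) n
    = (gen_poly delta)`_n.

(* Main.v *)
Require Import Defs.
From mathcomp Require Import all_boot all_order all_algebra.
From mathcomp Require Import finmap.
From mathcomp Require Import all_classical all_reals.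
From mathcomp Require Import zify.

Set Implicit Arguments.
Unset Strict Implicit.
Unset Printing Implicit Defensive.

Import Order.TTheory GRing.Theory Num.Theory.
Local Open Scope classical_set_scope.
Local Open Scope ring_scope.

(** An integral simplex with vertices V_0, ..., V_d is governed by a finite
abelian group.  Call box the set of w in [0,1)^(d+1) such that sum_i w_i V_i is
a lattice point and sum_i w_i, the height of w, is an integer; it is a group
under addition modulo 1.  A lattice point of the n-th dilate has unique
barycentric coordinates u >= 0 of sum n, and splitting u into its integral and
fractional parts yields a point of the box and an arbitrary vector of d+1
natural numbers with the complementary sum.  Hence
  i(P, n) = sum over the box of binomial(n - height + d, d),
and as (1 - X)^(d+1) times the series of binomial(n - h + d, d) is X^h, the
number delta_n counts the points of height n in the box
([is_delta_vector_box]).  Denominators in the box are bounded: if N is a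
multiple of the determinant of the edge vectors, then N w is integral, so the
box is a subgroup of (Z/N)^(d+1) and all the counting is finite.

When the sum of delta is 5 the box has order 5, and is thus generated by any
nonzero element; let g be one of minimal height, and h_k the height of k g.
Heights are subadditive, and h_k + h_(5-k) is the size of the support of k g,
the same for all k not divisible by 5, and at most d+1.  So
h_1 + h_4 = h_2 + h_3 <= d+1.  The sorted heights are h_1, the two numbers h_2
and h_3 in some order, h_4, and the inequalities of the theorem follow from
subadditivity ([delta_vector_inequalities]).

Conversely let s_a be the number of coordinates of g equal to a/5.  The
conditions on the s_a for the heights h_k to be i_k form a linear system whose
solutions are, with a parameter t,
  s_4 = t, s_3 = 2 i_1 - i_2 - t, s_2 = i_1 + i_2 - i_3 - t,
  s_1 = i_3 + i_4 - 2 i_1 + t,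
and the inequalities say that t = 0 gives natural numbers of sum at most d+1;
they have s_1 > 0 unless all i_k are equal, in which case t = 1 will do.  Any g
with a coordinate 1/N and integral height generates the box of some simplex,
with vertices 0, the first d-1 basis vectors, and one further vector read off
from g ([exists_cyclic_simplex]). *)

(** * Multiplication of a power series by a power of 1 - X *)

(** Modulo X^K the series is a polynomial, which makes the algebra of {poly int}
available. *)
Lemma mul_poly_seriesE (p : {poly int}) (a : nat -> int) (n K : nat) :
  (n < K)%N -> mul_poly_series p a n = (p * \poly_(k < K) a k)`_n.
Proof.
move=> nK; rewrite coefM; apply: eq_bigr => k _; rewrite coef_poly.
by rewrite (leq_ltn_trans (leq_subr _ _) nK).
Qed.

Lemma eq_mul_poly_series (p : {poly int}) (a b : nat -> int) :
  a =1 b -> mul_poly_series p a =1 mul_poly_series p b.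
Proof. by move=> ab n; apply: eq_bigr => k _; rewrite ab. Qed.

Lemma mul_poly_series_sum (I : finType) (P : pred I) (p : {poly int})
    (a : I -> nat -> int) (n : nat) :
  mul_poly_series p (fun k => \sum_(b | P b) a b k) n
  = \sum_(b | P b) mul_poly_series p (a b) n.
Proof.
by rewrite exchange_big; apply: eq_bigr => k _; rewrite mulr_sumr.
Qed.

Lemma mul_poly_series_exprS (m : nat) (a : nat -> int) (n : nat) :
  mul_poly_series ((1 - 'X) ^+ m.+1) a n
  = mul_poly_series ((1 - 'X) ^+ m)
      (fun k => a k - (if k is k'.+1 then a k' else 0)) n.
Proof.
rewrite (@mul_poly_seriesE _ _ n n.+1) // exprSr -mulrA coefM.
apply: eq_bigr => k _; congr (_ * _).
rewrite mulrBl mul1r coefB coefXM !coef_poly ltnS leq_subr.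
case: (n - k)%N (leq_subr k n) => [//|e] /= en.
by rewrite ltnS (ltnW en).
Qed.

(** The number of vectors of d+1 natural numbers with sum n - h. *)
Definition cone_series (d h n : nat) : nat :=
  if (h <= n)%N then 'C(n - h + d, d) else 0%N.

(** Each factor 1 - X takes a difference, which by Pascal's rule lowers d by
one. *)
Lemma mul_cone_series (d h n : nat) :
  mul_poly_series ((1 - 'X) ^+ d.+1) (fun k => (cone_series d h k)%:Z) n
  = (h == n)%:Z.
Proof.
elim: d => [|d IHd]; rewrite mul_poly_series_exprS.
  rewrite expr0 /mul_poly_series big_ord_recl big1 => [|k _]; last first.
    by rewrite coef1 mul0r.
  rewrite coef1 mul1r addr0 subn0 /cone_series.
  case: n => [|n]; first by rewrite leqn0 bin0 subr0; case: eqP.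
  by rewrite -(ltnS h n); case: (ltngtP h n.+1); rewrite ?bin0; lia.
rewrite -IHd; apply: eq_mul_poly_series => -[|k]; rewrite /cone_series.
  by rewrite leqn0 sub0n !add0n !binn subr0.
case: (ltngtP h k.+1) => [hk|hk|->].
- by rewrite -ltnS hk subSn // addSn binS addnS addSn; lia.
- by rewrite leqNgt (ltnW hk) subr0.
- by rewrite ltnn subnn !add0n !binn.
Qed.

(** * Counting multiples of 1/N by their residues *)

Section Counting.
Variable p : nat.
Notation N := p.+2.

(** The vector b stands for w = b/N in [0,1)^m; its height is the sum of the
w_i, and the division is exact on the vectors of the box. *)
Definition height (m : nat) (b : 'rV['Z_N]_m) : nat :=
  ((\sum_j (b ord0 j : nat)) %/ N)%N.

Definition residues (m K : nat) (c : {ffun 'I_m -> 'I_K}) : 'rV['Z_N]_m :=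
  \row_j (c j : nat)%:R.

(** Euclidean division c = b + N t: the quotient t is an arbitrary vector of
natural numbers with sum n - height b. *)
Lemma card_residue_class (d n K : nat) (b : 'rV['Z_N]_d.+1) :
  K = (N * n)%N ->
  (N %| \sum_j (b ord0 j : nat))%N ->
  #|[pred c : {ffun 'I_d.+1 -> 'I_K.+1} |
      (\sum_j (c j : nat) == K)%N && (residues c == b)%R]|
  = cone_series d (height b) n.
Proof.
move=> KE /divnK; rewrite -/(height b) mulnC => sum_b.
have bN j : (b ord0 j < N)%N by exact: ltn_ord.
rewrite /cone_series; case: leqP => [hn|nh]; last first.
  apply: eq_card0 => c; rewrite !inE; apply/negP => /andP[/eqP sum_c /eqP cb].
  have : (\sum_j (b ord0 j : nat) <= \sum_j (c j : nat))%N.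
    apply: leq_sum => j _; rewrite -cb mxE val_Zp_nat //; exact: leq_mod.
  by rewrite sum_c KE -sum_b leq_pmul2l // leqNgt nh.
rewrite addnC -card_ord_partitions.
pose f (t : d.+1.-tuple 'I_(n - height b).+1) : {ffun 'I_d.+1 -> 'I_K.+1}
  := [ffun j => inord (b ord0 j + N * tnth t j)].
have fE (t : d.+1.-tuple 'I_(n - height b).+1) :
    (\sum_(i <- t) i == n - height b)%N ->
    forall j, f t j = (b ord0 j + N * tnth t j)%N :> nat.
  move=> /eqP sum_t j; rewrite ffunE inordK // ltnS KE.
  have le_b : (b ord0 j <= N * height b)%N.
    by rewrite sum_b (bigD1 j) //= leq_addr.
  have le_t : (tnth t j <= n - height b)%N by rewrite -ltnS.
  apply: leq_trans (leq_add le_b (leq_mul (leqnn N) le_t)) _.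
  by rewrite -mulnDr subnKC.
set A := (X in _ = #|X|); have <- : #|(f @: A)%SET| = #|A|.
  apply: card_in_imset => t u; rewrite !inE => At Au ftu.
  apply: eq_from_tnth => j; apply: val_inj => /=.
  have := fE t At j; rewrite ftu fE // => /addnI /eqP.
  by rewrite eqn_pmul2l // => /eqP.
apply: eq_card => c; rewrite inE; apply/andP/imsetP => [[/eqP sum_c /eqP cb]|].
  have cE j : c j = (b ord0 j + N * (c j %/ N))%N :> nat.
    by rewrite -cb mxE val_Zp_nat // addnC (mulnC N (_ %/ _)%N); exact: divn_eq.
  have sum_q : (\sum_j (c j %/ N) = n - height b)%N.
    apply/eqP; rewrite -(eqn_add2l (height b)) subnKC //.
    rewrite -(@eqn_pmul2l N) // -KE mulnDr sum_b big_distrr /= -big_split /=.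
    by rewrite -[X in _ == X]sum_c; apply/eqP/eq_bigr => j _; rewrite -cE.
  have le_q j : (c j %/ N < (n - height b).+1)%N.
    by rewrite ltnS -sum_q (bigD1 j) //= leq_addr.
  have At : (\sum_(i <- [tuple Ordinal (le_q j) | j < d.+1]) i
             == n - height b)%N.
    rewrite big_tuple -[X in _ == X]sum_q; apply/eqP/eq_bigr => j _.
    by rewrite tnth_mktuple.
  exists [tuple Ordinal (le_q j) | j < d.+1]; first by rewrite inE.
  by apply/ffunP => j; apply: val_inj; rewrite [RHS](fE _ At) tnth_mktuple -cE.
case=> t; rewrite inE => At ->; split.
  rewrite (eq_bigr _ (fun j _ => fE t At j)) KE big_split /= -sum_b.
  rewrite -big_distrr /=.
  by rewrite -(big_tuple _ _ t xpredT val) (eqP At) -mulnDr subnKC.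
apply/eqP/rowP => j; rewrite mxE (fE _ At); apply: val_inj.
by rewrite /= val_Zp_nat // mulnC addnC modnMDl modn_small.
Qed.

Lemma card_residues (d n K : nat) (G : pred 'rV['Z_N]_d.+1) :
  K = (N * n)%N ->
  (forall b, G b -> N %| \sum_j (b ord0 j : nat))%N ->
  #|[pred c : {ffun 'I_d.+1 -> 'I_K.+1} |
      (\sum_j (c j : nat) == K)%N && G (residues c)]|
  = (\sum_(b | G b) cone_series d (height b) n)%N.
Proof.
move=> KE G_div; rewrite -sum1_card.
rewrite (partition_big (@residues _ _) G) => [|c]; last first.
  by rewrite inE => /andP[].
apply: eq_bigr => b Gb; rewrite -(card_residue_class KE) ?G_div // -?sum1_card.
apply: eq_bigl => c; rewrite !inE -andbA; congr (_ && _).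
by case: (eqVneq _ b) => [->|]; rewrite ?Gb ?andbF.
Qed.

End Counting.

(** * Simplices and barycentric coordinates *)

Definition edges (A : pzRingType) (n d : nat) (V : 'I_d.+1 -> 'rV[A]_n) :
    'M[A]_(d, n) :=
  \matrix_(j < d) (V (lift ord0 j) - V ord0).

(** Taking V_0 as origin turns affine combinations into linear combinations of
the edge vectors. *)
Lemma sum_scale_edges (A : comNzRingType) (n d : nat) (V : 'I_d.+1 -> 'rV[A]_n)
    (u : 'I_d.+1 -> A) :
  \sum_i u i *: V i
  = (\sum_i u i) *: V ord0 + (\row_j u (lift ord0 j)) *m edges V.
Proof.
rewrite mulmx_sum_row [in RHS]big_ord_recl big_ord_recl scalerDl -addrA.
congr (_ + _); rewrite scaler_suml -big_split; apply: eq_bigr => j _ /=.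
by rewrite mxE rowK scalerBr addrC subrK.
Qed.

Lemma barycentric_inj (R : realType) (n d : nat) (V : 'I_d.+1 -> 'rV[R]_n)
    (u v : 'I_d.+1 -> R) :
  affinely_independent V -> \sum_i u i = \sum_i v i ->
  \sum_i u i *: V i = \sum_i v i *: V i -> u =1 v.
Proof.
move=> V_free sum_uv; rewrite !sum_scale_edges sum_uv => /addrI.
move=> /(row_free_inj V_free) /rowP uv.
have uvS j : u (lift ord0 j) = v (lift ord0 j) by have := uv j; rewrite !mxE.
move=> i; case: (unliftP ord0 i) => [j ->|->]; first exact: uvS.
move: sum_uv; rewrite !big_ord_recl (eq_bigr _ (fun j _ => uvS j)).
exact: addIr.
Qed.

Lemma conv_hull_vertex (R : realType) (n m : nat) (V : 'I_m -> 'rV[R]_n) j :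
  conv_hull V (V j).
Proof.
exists (fun k => (k == j)%:R); split => [k||].
- exact: ler0n.
- by rewrite (bigD1 j) //= eqxx big1 ?addr0 // => k /negbTE ->.
- rewrite (bigD1 j) //= eqxx scale1r big1 ?addr0 // => k /negbTE ->.
  by rewrite scale0r.
Qed.

(** By uniqueness of barycentric coordinates, a convex combination of two points
that equals V_j has weight 0 at every other V_k, hence so has each of them. *)
Lemma vertex_simplex (R : realType) (n d : nat) (V : 'I_d.+1 -> 'rV[R]_n) j :
  affinely_independent V -> vertex (conv_hull V) (V j).
Proof.
move=> V_free; split; first exact: conv_hull_vertex.
suff key x y t : conv_hull V x -> conv_hull V y -> 0 < t < 1 ->
    V j = t *: x + (1 - t) *: y -> x = V j.
  move=> x y t Px Py t01 Vj; split; first exact: key Vj.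
  apply: (key y x (1 - t)) => //; last by rewrite subKr addrC.
  by move: t01; rewrite subr_gt0 gtrBl andbC.
case=> w [w_ge0 w_sum ->] [v [v_ge0 v_sum ->]] /andP[t0 t1].
rewrite !scaler_sumr -big_split /=.
under eq_bigr do rewrite !scalerA -scalerDl.
have -> : V j = \sum_k (k == j)%:R *: V k.
  rewrite (bigD1 j) //= eqxx scale1r big1 ?addr0 // => k /negbTE ->.
  by rewrite scale0r.
move=> /(barycentric_inj V_free) wv.
have {}wv k : (k == j)%:R = t * w k + (1 - t) * v k.
  apply: wv; rewrite big_split /= -!mulr_sumr w_sum v_sum !mulr1 addrC subrK.
  by rewrite (bigD1 j) //= eqxx big1 ?addr0 // => i /negbTE ->.
have w0 k : k != j -> w k = 0.
  move=> /negbTE kj; have := wv k; rewrite kj => /esym/eqP.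
  rewrite paddr_eq0 ?mulr_ge0 ?w_ge0 ?v_ge0 ?subr_ge0 ?ltW // => /andP[+ _].
  by rewrite mulf_eq0 gt_eqF //= => /eqP.
apply: eq_bigr => k _; congr (_ *: _).
case: eqVneq => [->|]; last exact: w0.
by move: w_sum; rewrite (bigD1 j) //= big1 ?addr0.
Qed.

(** If some weight w_j lies strictly between 0 and 1 then v is a proper convex
combination of V_j and of the normalized remainder y, so v = V_j. *)
Lemma vertex_conv_hull (R : realType) (n m : nat) (V : 'I_m -> 'rV[R]_n) v :
  vertex (conv_hull V) v -> exists j, v = V j.
Proof.
case=> -[w [w_ge0 w_sum vE]] v_ext.
have [j wj] : exists j, 0 < w j.
  apply/existsP; apply: contraT => /existsPn w_le0.
  have : \sum_j w j = 0.
    by apply: big1 => j _; apply/eqP; rewrite eq_le w_ge0 leNgt w_le0.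
  by move=> /eqP; rewrite w_sum oner_eq0.
exists j; have := w_sum; rewrite (bigD1 j) //=; set s := \sum_(_ | _) _ => ws.
have s_ge0 : 0 <= s by apply: sumr_ge0 => k _; exact: w_ge0.
move: s_ge0; rewrite le_eqVlt => /orP[/eqP s0|s_gt0].
  rewrite vE (bigD1 j) //= big1 => [|k kj]; last first.
    have /eqP := esym s0; rewrite psumr_eq0 => [|i _]; last exact: w_ge0.
    move=> /allP /(_ k (mem_index_enum _)); rewrite kj /= => /eqP ->.
    by rewrite scale0r.
  by move: ws; rewrite -s0 !addr0 => ->; rewrite scale1r.
have wj1 : 1 - w j = s by apply/eqP; rewrite subr_eq addrC ws.
pose y := \sum_(k | k != j) (w k / s) *: V k.
have Py : conv_hull V y.
  exists (fun k => if k != j then w k / s else 0); split=> [k||].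
  - by case: ifP => // _; rewrite divr_ge0 // ltW.
  - by rewrite -big_mkcond /= -mulr_suml divff // gt_eqF.
  - rewrite /y big_mkcond /=; apply: eq_bigr => k _.
    by case: ifP => // _; rewrite scale0r.
have [||//] := v_ext (V j) y (w j) (conv_hull_vertex V j) Py.
- by rewrite wj -ws ltrDl.
- rewrite vE (bigD1 j) //= wj1; congr (_ + _).
  rewrite scaler_sumr; apply: eq_bigr => k _.
  by rewrite scalerA mulrCA divff ?mulr1 // gt_eqF.
Qed.

(** * The box group and the delta-vector *)

Lemma natr_Zp_eq0 (p k : nat) : (k%:R == 0 :> 'Z_p.+2) = (p.+2 %| k)%N.
Proof. by rewrite -val_eqE /= val_Zp_nat. Qed.

Lemma intr_Zp_eq0 (p : nat) (z : int) :
  (z%:~R == 0 :> 'Z_p.+2) = (p.+2 %| z)%Z.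
Proof.
rewrite unfold_in /=; case: z => k; first exact: natr_Zp_eq0.
by rewrite NegzE mulrNz oppr_eq0 abszN; exact: natr_Zp_eq0.
Qed.

(** The vector b stands for w = b/N: modulo N, the two equations say that
sum_i w_i V_i is a lattice point and that sum_i w_i is an integer. *)
Definition box (p d n : nat) (V : 'I_d.+1 -> 'rV[int]_n) :
    pred 'rV['Z_p.+2]_d.+1 :=
  fun b => (\sum_i b ord0 i *: map_mx intr (V i) == 0 :> 'rV['Z_p.+2]_n)
        && (\sum_i b ord0 i == 0).

Lemma box_dvd_sum (p d n : nat) (V : 'I_d.+1 -> 'rV[int]_n) b :
  @box p d n V b -> (p.+2 %| \sum_i (b ord0 i : nat))%N.
Proof.
move=> /andP[_ /eqP sum_b]; rewrite -natr_Zp_eq0 natr_sum -[X in _ == X]sum_b.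
by apply/eqP; apply: eq_bigr => i _; rewrite natr_Zp.
Qed.

Lemma map_edges (A B : pzRingType) (f : {rmorphism A -> B}) (n d : nat)
    (V : 'I_d.+1 -> 'rV[A]_n) :
  map_mx f (edges V) = edges (fun i => map_mx f (V i)).
Proof. by apply/matrixP => i j; rewrite !mxE rmorphB. Qed.

(** The hypothesis on B says that N times the inverse of the edge matrix is
integral: barycentric coordinates of lattice points then have denominator N.
It also makes the edge matrix invertible over the reals. *)
Section LatticePoints.
Variables (R : realType) (p d : nat) (V : 'I_d.+1 -> 'rV[int]_d).
Variable B : 'M[int]_d.
Notation N := p.+2.
Hypothesis edgesB : edges V *m B = (N%:Z)%:M.

Let VR (i : 'I_d.+1) : 'rV[R]_d := map_mx intr (V i).

Lemma edgesB_real : edges VR *m map_mx intr B = (N%:R)%:M.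
Proof. by rewrite -map_edges -map_mxM edgesB map_scalar_mx. Qed.

Lemma affinely_independent_int : affinely_independent VR.
Proof.
have N_unit : N%:R \is a @GRing.unit R by rewrite unitfE pnatr_eq0.
rewrite /affinely_independent row_free_unit.
have : edges VR *m ((N%:R)^-1 *: map_mx intr B) = 1%:M.
  by rewrite -scalemxAr edgesB_real scale_scalar_mx mulVr.
by move=> /mulmx1_unit[].
Qed.

Definition lattice_point (K : nat) (c : {ffun 'I_d.+1 -> 'I_K}) : 'rV[R]_d :=
  \sum_i ((c i : nat)%:R / N%:R) *: VR i.

Lemma lattice_point_inj (K s : nat) (c e : {ffun 'I_d.+1 -> 'I_K}) :
  (\sum_i (c i : nat) = s)%N -> (\sum_i (e i : nat) = s)%N ->
  lattice_point c = lattice_point e -> c = e.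
Proof.
move=> sum_c sum_e /(barycentric_inj affinely_independent_int) ce.
apply/ffunP => i; apply: val_inj.
have /ce/(_ i) :
    \sum_i (c i : nat)%:R / N%:R = \sum_i (e i : nat)%:R / N%:R :> R.
  by rewrite -!mulr_suml -!natr_sum sum_c sum_e.
have N_unit : N%:R \is a @GRing.unit R by rewrite unitfE pnatr_eq0.
rewrite -unitrV in N_unit; move=> /(mulIr N_unit) /eqP.
by rewrite eqr_nat => /eqP.
Qed.

Lemma integer_lattice_point (K : nat) (c : {ffun 'I_d.+1 -> 'I_K}) :
  integer_points (lattice_point c) <->
  \sum_i (residues p c) ord0 i *: map_mx intr (V i) = 0.
Proof.
pose z j := \sum_i (c i : nat)%:Z * V i ord0 j.
have lE j : lattice_point c ord0 j = (z j)%:~R / N%:R.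
  rewrite /lattice_point summxE rmorph_sum /= mulr_suml; apply: eq_bigr => i _.
  by rewrite !mxE rmorphM /= mulrAC.
have rE j : (\sum_i (residues p c) ord0 i *: map_mx intr (V i)) ord0 j
            = (z j)%:~R.
  by rewrite summxE rmorph_sum; apply: eq_bigr => i _; rewrite !mxE rmorphM.
split => [c_int|c0 j]; last first.
  have /eqP : (z j)%:~R = 0 :> 'Z_N by rewrite -rE c0 mxE.
  rewrite intr_Zp_eq0 lE => /dvdzP[q ->].
  by rewrite rmorphM /= -pmulrn mulfK ?pnatr_eq0 // intr_int.
apply/rowP => j; rewrite rE mxE; apply/eqP; rewrite intr_Zp_eq0.
have /intrP[q] := c_int j; rewrite lE => /(congr1 ( *%R^~ N%:R)).
rewrite divfK ?pnatr_eq0 // => qE; apply/dvdzP; exists q.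
by apply: (@intr_inj R); rewrite qE rmorphM.
Qed.

(** Multiplying x - n V_0 by the integral matrix B yields the coordinates N w_i
for i > 0; the last one comes from the sum. *)
Lemma barycentric_integral (n : nat) (w : 'I_d.+1 -> R) :
  \sum_i w i = n%:R -> integer_points (\sum_i w i *: VR i) ->
  forall i, N%:R * w i \is a Num.int.
Proof.
move=> sum_w x_int.
have wS j : N%:R * w (lift ord0 j) \is a Num.int.
  have -> : N%:R * w (lift ord0 j)
      = ((\sum_i w i *: VR i - n%:R *: VR ord0) *m map_mx intr B) ord0 j.
    rewrite sum_scale_edges sum_w addrAC subrr add0r -mulmxA edgesB_real.
    by rewrite mul_mx_scalar !mxE.
  rewrite mxE rpred_sum // => k _; rewrite !mxE rpredM ?intr_int //.
  by rewrite rpredB ?x_int // rpredM ?intr_int ?rpred_nat.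
move=> i; case: (unliftP ord0 i) => [j ->|->]; first exact: wS.
move: sum_w; rewrite big_ord_recl => /eqP; rewrite -subr_eq0 -addrA addr_eq0.
move=> /eqP ->; rewrite opprB mulrBr mulr_sumr rpredB ?rpred_sum //.
  by rewrite rpredM ?rpred_nat.
Qed.

Lemma dilate_lattice_points (n : nat) :
  (0 < n)%N ->
  dilate n (conv_hull VR) `&` @integer_points R d
  = [set` [fset lattice_point c | c in
       [pred c : {ffun 'I_d.+1 -> 'I_(N * n).+1} |
         (\sum_i (c i : nat) == N * n)%N && box V (residues p c)]]%fset].
Proof.
move=> n_gt0; have n0 : n%:R != 0 :> R by rewrite pnatr_eq0 -lt0n.
have N0 : N%:R != 0 :> R by rewrite pnatr_eq0.
apply/seteqP; split=> x /=.
  case=> -[_ [w [w_ge0 w_sum ->]] <-] x_int; apply/imfsetP => /=.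
  move: x_int; rewrite scaler_sumr; under eq_bigr do rewrite scalerA.
  move=> x_int.
  have nw_sum : \sum_i n%:R * w i = n%:R by rewrite -mulr_sumr w_sum mulr1.
  have u_nat i : N%:R * (n%:R * w i) \is a Num.nat.
    by rewrite natrEint (barycentric_integral nw_sum) // !mulr_ge0 ?ler0n.
  pose u i := Num.truncn (N%:R * (n%:R * w i)).
  have uE i : (u i)%:R = N%:R * (n%:R * w i) by exact: truncnK.
  have u_sum : (\sum_i u i = N * n)%N.
    apply/eqP; rewrite -(eqr_nat R) natr_sum natrM -nw_sum mulr_sumr.
    by apply/eqP; apply: eq_bigr => i _.
  have u_lt i : (u i < (N * n).+1)%N.
    by rewrite ltnS -u_sum (bigD1 i) //= leq_addr.
  pose c := [ffun i => Ordinal (u_lt i)].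
  have xE : \sum_i (n%:R * w i) *: VR i = lattice_point c.
    apply: eq_bigr => i _; congr (_ *: _).
    by rewrite ffunE /= uE mulrAC mulfV // mul1r.
  exists c => //; apply/and3P; split.
  - by apply/eqP; rewrite -[RHS]u_sum; apply: eq_bigr => i _; rewrite ffunE.
  - by apply/eqP/integer_lattice_point; rewrite -xE.
  - under eq_bigr do rewrite mxE ffunE /=.
    by rewrite -natr_sum natr_Zp_eq0 u_sum dvdn_mulr.
move=> /imfsetP[c /= /and3P[/eqP c_sum /eqP c0 _] ->].
split; last exact/integer_lattice_point.
exists ((n%:R)^-1 *: lattice_point c); last by rewrite scalerA divff ?scale1r.
exists (fun i => (n%:R)^-1 * ((c i)%:R / N%:R)); split=> [i||].
- by rewrite mulr_ge0 ?divr_ge0 ?invr_ge0 ?ler0n.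
- rewrite -mulr_sumr -mulr_suml -natr_sum c_sum natrM.
  by rewrite (mulrC N%:R) mulfK // mulVf.
- by rewrite scaler_sumr; apply: eq_bigr => i _; rewrite scalerA.
Qed.

(** For n > 0 the lattice points of the dilate correspond to the numerators c of
their barycentric coordinates, which are counted by residues; for n = 0 the
only numerator is 0, in accordance with the convention i(P, 0) = 1. *)
Lemma ehrhart_box (n : nat) :
  ehrhart (conv_hull VR) n
  = (\sum_(b : 'rV['Z_N]_d.+1 | box V b) cone_series d (height b) n)%N.
Proof.
rewrite -(card_residues (K := N * n) erefl (@box_dvd_sum _ _ _ V)).
case: n => [|n].
  rewrite muln0; apply/esym/eqP/card1P; exists [ffun => ord0] => c.
  have c0 : c = [ffun => ord0] by apply/ffunP => i; rewrite ffunE [LHS]ord1.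
  rewrite !inE c0 eqxx; under eq_bigr do rewrite ffunE.
  rewrite sum_nat_const muln0 eqxx /= /box.
  by apply/andP; split; rewrite big1 // => i _; rewrite mxE ffunE ?scale0r.
rewrite /ehrhart dilate_lattice_points // set_fsetK card_in_imfset //=.
  rewrite cardE; apply/perm_size/uniq_perm;
    rewrite ?enum_uniq ?enum_finmem_uniq //.
move=> c e /andP[/eqP c_sum _] /andP[/eqP e_sum _].
exact: lattice_point_inj c_sum e_sum.
Qed.

(** Each point b of the box contributes one summand to the Ehrhart function,
whose series times (1 - X)^(d+1) is the monomial X^(height b). *)
Lemma is_delta_vector_box (delta : 'I_d.+1 -> int) :
  is_delta_vector (conv_hull VR) delta <->
  forall n, (gen_poly delta)`_n
    = \sum_(b : 'rV['Z_N]_d.+1 | box V b) (height b == n)%:Z.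
Proof.
have key n : mul_poly_series ((1 - 'X) ^+ d.+1)
      (fun m => (ehrhart (conv_hull VR) m)%:Z) n
    = \sum_(b : 'rV['Z_N]_d.+1 | box V b) (height b == n)%:Z.
  under eq_mul_poly_series do rewrite ehrhart_box (big_morph Posz PoszD erefl).
  rewrite mul_poly_series_sum; apply: eq_bigr => b _.
  exact: mul_cone_series.
by split=> delta_box n; [rewrite -key|rewrite key]; rewrite delta_box.
Qed.

End LatticePoints.

(** * Groups of prime order and heights *)

Lemma zmod_closed_mulrn (V : zmodType) (G : {pred V}) (g : V) (k : nat) :
  zmod_closed G -> g \in G -> g *+ k \in G.
Proof.
case=> G0 GB Gg; elim: k => [|k IHk]; first by rewrite mulr0n.
by rewrite mulrS addrC -[X in _ + X]opprK GB // -[- g]add0r GB.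
Qed.

Section PrimeOrder.
Variables (V : finZmodType) (G : {pred V}) (q : nat) (g : V).
Hypotheses (q_prime : prime q) (G_closed : zmod_closed G) (card_G : #|G| = q).
Hypotheses (Gg : g \in G) (g_neq0 : g != 0).

(** Translation by g permutes G, so the sum of the elements of G is unchanged
when #|G| copies of g are added to it. *)
Lemma mulrn_prime_order : g *+ q = 0.
Proof.
have [G0 GB] := G_closed.
have GD x : (x + g \in G) = (x \in G).
  apply/idP/idP => Gx; first by rewrite -(addrK g x) GB.
  by rewrite -(opprK g) GB // -[- g]add0r GB.
have /eqP : \sum_(x in G) x = \sum_(x in G) (x + g).
  rewrite (reindex_inj (addIr g)) /=; exact: eq_bigl.
rewrite big_split /= sumr_const card_G addrC -subr_eq subrr eq_sym.
by move=> /eqP.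
Qed.

(** Otherwise g is killed by q and by some positive e < q, hence by their gcd 1,
by Bezout. *)
Lemma mulrn_prime_order_inj (k l : nat) :
  (k < q)%N -> (l < q)%N -> g *+ k = g *+ l -> k = l.
Proof.
wlog kl : k l / (k <= l)%N => [wlog_kl kq lq gkl|kq lq gkl].
  by case: (leqP k l) => [|/ltnW] kl; [|apply/esym]; exact: wlog_kl.
apply/eqP; rewrite eqn_leq kl leqNgt; apply: contraNN g_neq0 => k_lt_l.
have e_gt0 : (0 < l - k)%N by rewrite subn_gt0.
have ge : g *+ (l - k) = 0 by rewrite mulrnBr // gkl subrr.
have qe : coprime (l - k) q.
  rewrite coprime_sym prime_coprime // gtnNdvd //.
  exact: leq_ltn_trans (leq_subr _ _) lq.
case: (egcdnP q e_gt0) => u v uv _.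
have /eqP := congr1 (fun t => g *+ t) uv; rewrite (eqP qe) mulrnDr mulr1n.
rewrite (mulnC u) (mulnC v) !mulrnA ge mulrn_prime_order !mul0rn add0r.
by rewrite eq_sym.
Qed.

Lemma sum_prime_order (S : nmodType) (F : V -> S) :
  \sum_(b in G) F b = \sum_(k < q) F (g *+ k).
Proof.
have h_inj : injective (fun k : 'I_q => g *+ k).
  by move=> k l gkl; apply: val_inj; exact: mulrn_prime_order_inj gkl.
rewrite -(big_imset (h := fun k : 'I_q => g *+ k) (A := predT)); last first.
  by move=> k l _ _; exact: h_inj.
apply: eq_bigl; apply/fsym/subset_cardP.
  by rewrite card_imset // card_G card_ord.
by apply/fintype.subsetP => _ /imsetP[k _ ->]; exact: zmod_closed_mulrn.
Qed.

End PrimeOrder.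

Section Heights.
Variables (p m : nat).
Notation N := p.+2.
Implicit Types b c : 'rV['Z_N]_m.

Definition height_dvd b := (N %| \sum_j (b ord0 j : nat))%N.

Lemma height_mul b : height_dvd b ->
  (height b * N = \sum_j (b ord0 j : nat))%N.
Proof. exact: divnK. Qed.

(** Reduction modulo N never increases a coordinate. *)
Lemma height_add b c : height_dvd b -> height_dvd c -> height_dvd (b + c) ->
  (height (b + c) <= height b + height c)%N.
Proof.
move=> Nb Nc Nbc; rewrite -(@leq_pmul2r N) // mulnDl !height_mul // -big_split.
by apply: leq_sum => j _; rewrite mxE; exact: leq_mod.
Qed.

(** A coordinate x and its opposite, as residues, add up to N unless x = 0. *)
Lemma height_opp b : height_dvd b -> height_dvd (- b) ->
  (height b + height (- b) = #|[pred j | b ord0 j != 0%R]|)%N.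
Proof.
move=> Nb NNb; apply/eqP; rewrite -(@eqn_pmul2r N) // mulnDl !height_mul //.
rewrite -big_split /= -sum1_card big_distrl /= [X in _ == X]big_mkcond /=.
apply/eqP; apply: eq_bigr => j _; rewrite !mxE inE.
case: eqVneq => [->|bj0]; first by rewrite oppr0.
rewrite mul1n /= modn_small ?subnKC //; first exact: ltnW.
by rewrite ltn_subrL lt0n andbT; exact: bj0.
Qed.

End Heights.

Lemma box_zmod_closed (p d n : nat) (V : 'I_d.+1 -> 'rV[int]_n) :
  zmod_closed (@box p d n V).
Proof.
split=> [|b c]; rewrite !unfold_in.
  by apply/andP; split; rewrite big1 // => i _; rewrite mxE ?scale0r.
move=> /andP[/eqP b0 /eqP bs] /andP[/eqP c0 /eqP cs].
under eq_bigr do rewrite !mxE scalerBl.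
under [X in _ && (X == 0)]eq_bigr do rewrite !mxE.
by rewrite !sumrB b0 c0 bs cs !subrr !eqxx.
Qed.

(** * Heights in a group of order 5 *)

Section Order5.
Variables (p d : nat) (G : {pred 'rV['Z_p.+2]_d.+1}).
Hypotheses (G_closed : zmod_closed G).
Hypothesis G_dvd : forall b, b \in G -> height_dvd b.

Lemma heights_order5 (h : nat -> nat) (g : 'rV['Z_p.+2]_d.+1) :
  #|G| = 5%N -> g \in G -> g != 0 -> (forall k, h k = height (g *+ k)) ->
  [/\ h 0 = 0, h 1 + h 4 = h 2 + h 3, h 1 + h 4 <= d.+1
    & [/\ h 2 <= h 1 + h 1, h 3 <= h 1 + h 2, h 4 <= h 1 + h 3
        & h 4 <= h 2 + h 2]]%N.
Proof.
move=> card_G Gg g0 hE.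
have g5 : g *+ 5 = 0 by exact: mulrn_prime_order G_closed card_G Gg.
have GM k : g *+ k \in G by exact: zmod_closed_mulrn.
have h_add k l : (h (k + l) <= h k + h l)%N.
  by rewrite !hE mulrnDr; apply: height_add; rewrite -?mulrnDr G_dvd.
have h_opp k : (k <= 5)%N ->
    (h k + h (5 - k) = #|[pred j | (g *+ k) ord0 j != 0%R]|)%N.
  move=> k5; have gN : g *+ (5 - k) = - (g *+ k).
    by rewrite mulrnBr // g5 add0r.
  by rewrite !hE gN height_opp -?gN ?G_dvd.
(* Since 6 = 1 modulo 5, doubling does not change the support. *)
have supp2 j : ((g *+ 2) ord0 j == 0) = (g ord0 j == 0).
  have g5j : g ord0 j *+ 5 = 0 by rewrite -mulmxnE g5 mxE.
  rewrite mulmxnE; apply/eqP/eqP => [g2|->]; last by rewrite mul0rn.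
  by rewrite -[LHS]addr0 -g5j -mulrS (mulrnA _ 2 3) g2 mul0rn.
split; last by split; exact: h_add.
- by rewrite hE mulr0n /height big1 ?div0n // => j _; rewrite mxE.
- rewrite (h_opp 1%N) // (h_opp 2%N) //; apply: eq_card => j.
  by rewrite !inE supp2 mulr1n.
- by rewrite (h_opp 1%N) // (leq_trans (max_card _)) ?card_ord.
Qed.

(** Replacing the generator g by a multiple of it permutes h_1, ..., h_4 and
makes h_1 the smallest of them, which settles their order up to exchanging h_2
and h_3. *)
Lemma heights_order5_min :
  #|G| = 5%N ->
  exists h : nat -> nat,
  [/\ (forall n,
         \sum_(b in G) (height b == n)%:Z = \sum_(k < 5) (h k == n)%:Z)%R,
      [/\ h 0 = 0, h 1 <= h 2, h 1 <= h 3 & h 1 <= h 4],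
      h 1 + h 4 = h 2 + h 3 /\ h 1 + h 4 <= d.+1
    & [/\ h 2 <= h 1 + h 1, h 3 <= h 1 + h 2, h 4 <= h 1 + h 3
        & h 4 <= h 2 + h 2]]%N.
Proof.
move=> card_G.
have [g0 /andP[Gg0 g0_neq0]] : exists g, (g \in G) && (g != 0).
  apply/existsP; apply: contraT => /existsPn G_triv.
  suff : (#|G| <= 1)%N by rewrite card_G.
  rewrite -[X in (_ <= X)%N](card1 (0 : 'rV['Z_p.+2]_d.+1)).
  apply: subset_leq_card.
  apply/fintype.subsetP => g Gg; have := G_triv g.
  by rewrite Gg /= negbK.
pose P := [pred g | (g \in G) && (g != 0)].
have Pg0 : P g0 by rewrite /= Gg0.
case: (arg_minnP (@height p d.+1) Pg0) => g /andP[Gg g_neq0] g_min.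
exists (fun k => height (g *+ k)).
have [h0 h14 hd h_add] := heights_order5 card_G Gg g_neq0 (fun k => erefl).
have h_min k : (0 < k < 5)%N -> (height (g *+ 1) <= height (g *+ k))%N.
  case/andP=> k0 k5; rewrite mulr1n; apply: g_min; apply/andP; split.
    exact: zmod_closed_mulrn.
  apply: contraL k0 => /eqP gk; rewrite -eqn0Ngt; apply/eqP.
  by apply: (mulrn_prime_order_inj _ G_closed card_G Gg g_neq0 k5).
split=> //; last by split=> //; exact: h_min.
by move=> n; rewrite (sum_prime_order _ G_closed card_G Gg g_neq0).
Qed.

End Order5.

Lemma eq_four_exponents (a b c e : nat) (i1 i2 i3 i4 : nat) :
  (forall n, (a == n) + (b == n) + (c == n) + (e == n)
    = (i1 == n) + (i2 == n) + (i3 == n) + (i4 == n))%N ->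
  perm_eq [:: a; b; c; e] [:: i1; i2; i3; i4].
Proof.
move=> ab; rewrite /perm_eq; apply/allP => n _ /=; apply/eqP.
by rewrite !addnA !addn0.
Qed.

Lemma sorted_four_exponents (a b c e : nat) (i1 i2 i3 i4 : nat) :
  (a <= b)%N -> (b <= c)%N -> (c <= e)%N ->
  (i1 <= i2)%N -> (i2 <= i3)%N -> (i3 <= i4)%N ->
  perm_eq [:: a; b; c; e] [:: i1; i2; i3; i4] ->
  [/\ a = i1, b = i2, c = i3 & e = i4].
Proof.
move=> ab bc ce i12 i23 i34 perm_ai.
have [] // : [:: a; b; c; e] = [:: i1; i2; i3; i4].
apply: (sorted_eq leq_trans anti_leq) => //=.
  by rewrite ab bc ce.
by rewrite i12 i23 i34.
Qed.

(** * From the simplex to the inequalities *)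

(** The adjugate inverts A up to its determinant; the factor 2 makes the modulus
at least 2. *)
Lemma clear_denominators (d : nat) (A : 'M[int]_d) :
  \det A != 0 -> exists (p : nat) (B : 'M[int]_d), A *m B = ((p.+2)%:Z)%:M.
Proof.
move=> A0.
pose D := (2 * Num.sg (\det A) * \det A).
have DE : D = (`|\det A|.*2)%:Z.
  by rewrite /D -mulrA -normrEsg -mul2n PoszM abszE.
have D2 : (2 <= `|\det A|.*2)%N by rewrite (leq_double 1) absz_gt0.
exists (`|\det A|.*2 - 2)%N, ((2 * Num.sg (\det A)) *: \adj A).
by rewrite -scalemxAr mul_mx_adj scale_scalar_mx -/D DE -addn2 subnK.
Qed.

Section IntegralSimplices.
Variables (R : realType) (d : nat) (delta : 'I_d.+1 -> int).

Lemma int_vertices (P : set 'rV[R]_d) :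
  integral_simplex d P ->
  exists V : 'I_d.+1 -> 'rV[int]_d,
    \det (edges V) != 0
    /\ P = conv_hull (fun i => map_mx intr (V i) : 'rV[R]_d).
Proof.
case=> -[_ P_int] [V [V_free PE]].
have V_int i : integer_points (V i).
  by apply: P_int; rewrite PE; exact: vertex_simplex.
pose Z i : 'rV[int]_d := \row_j Num.floor (V i ord0 j).
have ZE i : map_mx intr (Z i) = V i.
  by apply/rowP => j; rewrite !mxE; apply/floorK/V_int.
exists Z; split; last first.
  by rewrite PE; congr conv_hull; apply/funext => i; rewrite ZE.
move: V_free; rewrite /affinely_independent row_free_unit unitmxE unitfE.
have -> : \matrix_(j < d) (V (lift ord0 j) - V ord0) = map_mx intr (edges Z).
  by apply/row_matrixP => j; rewrite rowK map_edges /edges rowK !ZE.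
by rewrite det_map_mx intr_eq0.
Qed.

Lemma coef_gen_poly_sum :
  \sum_(n < d.+1) (gen_poly delta)`_n = \sum_(k < d.+1) delta k.
Proof.
apply: eq_bigr => n _; rewrite /gen_poly coef_sum (bigD1 n) //= coefZ coefXn.
rewrite eqxx mulr1 big1 ?addr0 // => k kn.
by rewrite coefZ coefXn eq_sym (inj_eq val_inj) (negbTE kn) mulr0.
Qed.

Lemma height_le (p : nat) (b : 'rV['Z_p.+2]_d.+1) : (height b < d.+1)%N.
Proof.
rewrite ltnS -ltnS ltn_divLR // -[X in (_ < X * _)%N]card_ord -sum_nat_const.
rewrite -subn_gt0 -sumnB => [|j _]; last exact/ltnW/ltn_ord.
by rewrite (bigD1 ord0) //= ltn_addr // subn_gt0 ltn_ord.
Qed.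

Lemma card_box (p : nat) (V : 'I_d.+1 -> 'rV[int]_d) :
  (forall n, (gen_poly delta)`_n
    = \sum_(b : 'rV['Z_p.+2]_d.+1 | box V b) (height b == n)%:Z) ->
  (#|@box p _ _ V|)%:Z = \sum_(k < d.+1) delta k.
Proof.
move=> deltaE; rewrite -coef_gen_poly_sum; under [RHS]eq_bigr do rewrite deltaE.
rewrite exchange_big -sum1_card (big_morph Posz PoszD erefl) /=.
apply: eq_bigr => b _; rewrite (bigD1 (Ordinal (height_le b))) //= eqxx.
rewrite big1 ?addr0 // => k kb; rewrite -(inj_eq val_inj) /= eq_sym in kb.
by rewrite (negbTE kb).
Qed.

End IntegralSimplices.

(** In both orders of h_2 and h_3 the inequalities hold: for instance when
h_3 < h_2, the bound i_3 <= i_1 + i_2 follows from h_2 <= 2 h_1. *)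
Lemma sorted_heights (h1 h2 h3 h4 m i1 i2 i3 i4 : nat) :
  (h1 <= h2 -> h1 <= h3 -> h1 + h4 = h2 + h3 -> h1 + h4 <= m ->
  h2 <= h1 + h1 -> h3 <= h1 + h2 -> h4 <= h1 + h3 -> h4 <= h2 + h2 ->
  i1 <= i2 -> i2 <= i3 -> i3 <= i4 ->
  perm_eq [:: h1; h2; h3; h4] [:: i1; i2; i3; i4] ->
  [/\ i1 + i4 = i2 + i3, i2 + i3 <= m
    & [/\ i2 <= i1 + i1, i3 <= i1 + i2, i4 <= i1 + i3 & i4 <= i2 + i2]])%N.
Proof.
move=> h12 h13 h1423 hm h211 h312 h413 h422 i12 i23 i34 h_perm.
have [h24 h34] : (h2 <= h4)%N /\ (h3 <= h4)%N by clear h_perm; lia.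
case: (leqP h2 h3) => [h23|/ltnW h32].
  have [e1 e2 e3 e4] := sorted_four_exponents h12 h23 h34 i12 i23 i34 h_perm.
  by clear h_perm; subst; split; [lia|lia|split; lia].
have {}h_perm : perm_eq [:: h1; h3; h2; h4] [:: i1; i2; i3; i4].
  apply: perm_trans h_perm; rewrite perm_cons.
  exact: permEl (perm_catCA [:: h3] [:: h2] [:: h4]).
have [e1 e2 e3 e4] := sorted_four_exponents h13 h32 h24 i12 i23 i34 h_perm.
by clear h_perm; subst; split; [lia|lia|split; lia].
Qed.

Lemma delta_vector_inequalities (R : realType) (d : nat)
    (delta : 'I_d.+1 -> int) (i1 i2 i3 i4 : nat) (P : set 'rV[R]_d) :
  \sum_(k < d.+1) delta k = 5 ->
  (i1 <= i2)%N -> (i2 <= i3)%N -> (i3 <= i4)%N ->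
  gen_poly delta = 1 + 'X^i1 + 'X^i2 + 'X^i3 + 'X^i4 ->
  integral_simplex d P -> is_delta_vector P delta ->
  [/\ i1 + i4 = i2 + i3, i2 + i3 <= d + 1
    & [/\ i2 <= i1 + i1, i3 <= i1 + i2, i4 <= i1 + i3 & i4 <= i2 + i2]]%N.
Proof.
move=> delta_sum i12 i23 i34 deltaE /int_vertices[V [detV ->]].
have [p [B VB]] := clear_denominators detV.
move=> /(is_delta_vector_box _ VB) delta_box.
have card_G : #|@box p _ _ V| = 5%N.
  by apply/eqP; rewrite -eqz_nat (card_box delta_box) delta_sum.
have G_dvd b : b \in @box p _ _ V -> height_dvd b by exact: box_dvd_sum.
have [h [h_box [h0 h12 h13 h14] [h1423 hd] [h2 h3 h4 h4']]] :=
  heights_order5_min (@box_zmod_closed p d d V) G_dvd card_G.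
have h_perm : perm_eq [:: h 1%N; h 2%N; h 3%N; h 4%N] [:: i1; i2; i3; i4].
  apply: eq_four_exponents => n; apply/eqP; rewrite -eqz_nat; apply/eqP.
  have := delta_box n; rewrite deltaE !coefD coef1 !coefXn h_box.
  rewrite !big_ord_recl big_ord0 /= h0 !(eq_sym n).
  by rewrite !natz !PoszD addr0 -!addrA => /addrI ->.
by rewrite addn1; apply: sorted_heights h_perm.
Qed.

(** * A simplex with prescribed cyclic box *)

Section Construction.
Variables (p d : nat) (g : 'rV['Z_p.+2]_d.+2).
Notation N := p.+2.
Hypotheses (g_last : g ord0 ord_max = 1) (g_sum : \sum_i g ord0 i = 0).

(** The last vertex is chosen so that, modulo N, the equation of the box in
column j reads b_(j+1) = b_last g_(j+1).  In the last column the shift is the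
residue N-1 of -1, so that the last coordinate of the last vertex is N. *)
Definition last_shift : 'rV[int]_d.+1 :=
  \row_j ((- g ord0 (lift ord0 j) : 'Z_N) : nat)%:Z.

Definition simplex_vertex (i : 'I_d.+2) : 'rV[int]_d.+1 :=
  \row_j ((i == lift ord0 j)%:Z + (i == ord_max)%:Z * last_shift ord0 j).

Let ord_maxE : ord_max = lift ord0 ord_max :> 'I_d.+2.
Proof. exact: val_inj. Qed.

Lemma edges_simplex_vertex :
  edges simplex_vertex
  = 1%:M + delta_mx ord_max ord0 *m last_shift.
Proof.
apply/matrixP => i j.
rewrite !mxE big_ord1 !mxE /= !eqxx !mul0r !add0r subr0 andbT.
by rewrite (inj_eq lift_inj) ord_maxE (inj_eq lift_inj) !natz.
Qed.

(** The edge matrix is 1 + E with E^2 = (N-1) E, hence its product with N - E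
is N. *)
Lemma edges_simplex_vertexM :
  edges simplex_vertex *m ((N%:Z)%:M - delta_mx ord_max ord0 *m last_shift)
  = (N%:Z)%:M.
Proof.
rewrite edges_simplex_vertex; set E := delta_mx _ _ *m _.
have EE : E *m E = (p.+1)%:Z *: E.
  rewrite /E mulmxA -(mulmxA _ last_shift).
  have -> : last_shift *m delta_mx ord_max ord0 = ((p.+1)%:Z)%:M :> 'M_1.
    apply/rowP => j; rewrite !ord1 mxE (bigD1 ord_max) //= big1.
      rewrite !mxE -ord_maxE g_last !eqxx /=.
      by rewrite mulr1 addr0 [(1 %% _)%N]modn_small // subn1 modn_small.
    by move=> k /negbTE kn; rewrite !mxE kn mulr0.
  by rewrite mul_mx_scalar scalemxAl.
have EN : E + (p.+1)%:Z *: E = N%:Z *: E.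
  by rewrite -[X in X + _]scale1r -scalerDl.
by rewrite mulmxBr !mulmxDl !mul1mx EE EN mul_mx_scalar addrK.
Qed.

Lemma box_simplex_vertex (b : 'rV['Z_N]_d.+2) :
  box simplex_vertex b = (b == b ord0 ord_max *: g).
Proof.
have shiftE j : (last_shift ord0 j)%:~R = - g ord0 (lift ord0 j) :> 'Z_N.
  by rewrite mxE -pmulrn natr_Zp.
have vE j :
    (\sum_i b ord0 i *: map_mx intr (simplex_vertex i) : 'rV['Z_N]_d.+1) ord0 j
    = b ord0 (lift ord0 j) - b ord0 ord_max * g ord0 (lift ord0 j).
  rewrite summxE; under eq_bigr do rewrite 3!mxE rmorphD rmorphM /= mulrDr.
  rewrite big_split /=; congr (_ + _).
    rewrite (bigD1 (lift ord0 j)) //= eqxx mulr1 big1 ?addr0 // => i /negbTE ->.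
    by rewrite mulr0.
  rewrite (bigD1 ord_max) //= eqxx mul1r big1 ?addr0 => [|i /negbTE ->].
    by rewrite shiftE mulrN.
  by rewrite mul0r mulr0.
apply/andP/eqP => [[/eqP b0 /eqP b_sum]|bE].
  have bS j : b ord0 (lift ord0 j) = b ord0 ord_max * g ord0 (lift ord0 j).
    by apply/eqP; rewrite -subr_eq0 -vE b0 mxE.
  apply/rowP => i; rewrite mxE; case: (unliftP ord0 i) => [j ->|->] //.
  have : \sum_i b ord0 i = b ord0 ord_max * \sum_i g ord0 i.
    by rewrite b_sum g_sum mulr0.
  rewrite mulr_sumr !(@big_ord_recl _ _ _ d.+1).
  rewrite (eq_bigr _ (fun j _ => bS j)); exact: addIr.
split; last first.
  by rewrite bE; under eq_bigr do rewrite mxE; rewrite -mulr_sumr g_sum mulr0.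
by apply/eqP/rowP => j; rewrite vE {1}bE !mxE subrr.
Qed.

Lemma sum_box_simplex_vertex (S : nmodType) (F : 'rV['Z_N]_d.+2 -> S) :
  \sum_(b | box simplex_vertex b) F b = \sum_(k : 'Z_N) F (k *: g).
Proof.
have gK k : (k *: g) ord0 ord_max = k by rewrite mxE g_last mulr1.
rewrite (reindex_onto (fun k : 'Z_N => k *: g) (fun b => b ord0 ord_max)).
  by apply: eq_bigl => k; rewrite box_simplex_vertex gK !eqxx.
by move=> b; rewrite box_simplex_vertex => /eqP <-.
Qed.

Lemma exists_cyclic_simplex (R : realType) : exists P : set 'rV[R]_d.+1,
  integral_simplex d.+1 P /\
  forall delta : 'I_d.+2 -> int,
    (forall n, (gen_poly delta)`_n
       = \sum_(k : 'Z_N) (height (k *: g) == n)%:Z) ->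
    is_delta_vector P delta.
Proof.
pose V i : 'rV[R]_d.+1 := map_mx intr (simplex_vertex i).
exists (conv_hull V); split.
  split; last first.
    exists V; split=> //.
    exact: affinely_independent_int edges_simplex_vertexM.
  split; first by exists d.+2, V.
  by move=> v /vertex_conv_hull[i ->] j; rewrite mxE intr_int.
move=> delta deltaE; apply/(is_delta_vector_box R edges_simplex_vertexM) => n.
by rewrite deltaE sum_box_simplex_vertex.
Qed.

End Construction.

(** * From the inequalities to the simplex *)

(** Here s_a is the number of coordinates a/5 of the generator, and the k-th
equation prescribes the height of its k-th multiple.  The solution with s_4 = 0
has s_1 > 0, as needed for the last coordinate, unless all i_k are equal; then
the one with s_4 = 1 does. *)
Lemma exists_multiplicities (i1 i2 i3 i4 : nat) :
  (1 <= i1 -> i1 <= i2 -> i2 <= i3 -> i3 <= i4 -> i1 + i4 = i2 + i3 ->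
   i2 <= i1 + i1 -> i3 <= i1 + i2 ->
  exists s1 s2 s3 s4 : nat, 0 < s1 /\
   [/\ s1 + s2 + s3 + s4 = i1 + i4,
       1 * s1 + 2 * s2 + 3 * s3 + 4 * s4 = 5 * i1,
       2 * s1 + 4 * s2 + 1 * s3 + 3 * s4 = 5 * i2,
       3 * s1 + 1 * s2 + 4 * s3 + 2 * s4 = 5 * i3
     & 4 * s1 + 3 * s2 + 2 * s3 + 1 * s4 = 5 * i4])%N.
Proof.
move=> i1_gt0 i12 i23 i34 i1423 i2_le i3_le.
case: (ltnP (i1 + i1) (i3 + i4)) => [s1_gt0|i34_le].
  exists (i3 + i4 - (i1 + i1))%N, (i1 + i2 - i3)%N, (i1 + i1 - i2)%N, 0%N.
  by split; [|split]; lia.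
exists 1%N, i1.-1, i1.-1, 1%N.
by split; [|split]; lia.
Qed.

Section WeightSequence.
Variables (d : nat) (L : seq 'Z_5).
Hypothesis size_L : size L = d.+1.

Definition row_of_seq : 'rV['Z_5]_d.+1 := \row_j nth 0 L j.

Lemma height_row_of_seq (k : 'Z_5) :
  height (k *: row_of_seq) = ((\sum_(x <- L) (k * x) %% 5) %/ 5)%N.
Proof.
rewrite /height (@big_nth _ _ _ _ 0 L) size_L big_mkord; congr (_ %/ _)%N.
by apply: eq_bigr => j _; rewrite !mxE.
Qed.

Lemma sum_row_of_seq :
  (5 %| \sum_(x <- L) (x : nat))%N -> \sum_j row_of_seq ord0 j = 0.
Proof.
rewrite (@big_nth _ _ _ _ 0 L) size_L big_mkord -natr_Zp_eq0 natr_sum.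
move=> /eqP L0; rewrite -[RHS]L0.
by apply: eq_bigr => j _; rewrite mxE natr_Zp.
Qed.

End WeightSequence.

(** The residue 1 comes last, where the construction of the simplex needs it. *)
Definition residue_seq (s0 s1 s2 s3 s4 : nat) : seq 'Z_5 :=
  nseq s0 0 ++ nseq s4 (inZp 4) ++ nseq s3 (inZp 3) ++ nseq s2 (inZp 2)
  ++ nseq s1 (inZp 1).

Lemma sum_residue_seq (s0 s1 s2 s3 s4 : nat) (F : nat -> nat) :
  (\sum_(x <- residue_seq s0 s1 s2 s3 s4) F x
   = F 0 * s0 + (F 4 * s4 + (F 3 * s3 + (F 2 * s2 + F 1 * s1))))%N.
Proof. by rewrite !big_cat /= !big_nseq !iter_addn_0. Qed.

Lemma exists_simplex_of_inequalities (R : realType) (d : nat)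
    (delta : 'I_d.+1 -> int) (i1 i2 i3 i4 : nat) :
  (1 <= i1)%N -> (i1 <= i2)%N -> (i2 <= i3)%N -> (i3 <= i4)%N -> (i4 <= d)%N ->
  gen_poly delta = 1 + 'X^i1 + 'X^i2 + 'X^i3 + 'X^i4 ->
  (i1 + i4 = i2 + i3)%N -> (i1 + i4 <= d.+1)%N ->
  (i2 <= i1 + i1)%N -> (i3 <= i1 + i2)%N ->
  exists P : set 'rV[R]_d, integral_simplex d P /\ is_delta_vector P delta.
Proof.
move=> i1_gt0 i12 i23 i34 i4d deltaE i1423 i14d i2_le i3_le.
have [s1 [s2 [s3 [s4 [s1_gt0 [sumE h1 h2 h3 h4]]]]]] :=
  exists_multiplicities i1_gt0 i12 i23 i34 i1423 i2_le i3_le.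
have d_gt0 : (0 < d)%N by lia.
case: d d_gt0 => // d _ in delta i4d deltaE i14d *.
pose L := residue_seq (d.+2 - (i1 + i4)) s1 s2 s3 s4.
have size_L : size L = d.+2.
  by rewrite /L /residue_seq !size_cat !size_nseq; lia.
have g_last : row_of_seq d.+1 L ord0 ord_max = 1.
  rewrite mxE /= -[X in nth _ _ X]/(d.+2.-1) -size_L nth_last /L /residue_seq.
  rewrite !last_cat -(prednK s1_gt0) /=.
  by elim: s1.-1.
have g_sum : \sum_j row_of_seq d.+1 L ord0 j = 0.
  apply: sum_row_of_seq => //; rewrite (sum_residue_seq _ _ _ _ _ id).
  by apply/dvdnP; exists i1; lia.
have [P [P_simplex P_delta]] := exists_cyclic_simplex g_last g_sum R.
exists P; split=> //; apply: P_delta => n.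
have heightE (k : 'Z_5) (h : nat) :
    ((k * 1) %% 5 * s1 + (k * 2) %% 5 * s2 + (k * 3) %% 5 * s3
      + (k * 4) %% 5 * s4 = 5 * h)%N ->
    height (k *: row_of_seq d.+1 L) = h.
  move=> kE; rewrite height_row_of_seq //.
  rewrite (sum_residue_seq _ _ _ _ _ (fun y => (k * y) %% 5)%N).
  rewrite muln0 mod0n.
  suff -> : forall a b c e : nat,
      (0 * (d.+2 - (i1 + i4)) + (a + (b + (c + e))) = e + c + b + a)%N.
    by rewrite kE mulKn.
  by clear; lia.
have heights k :
    height (k *: row_of_seq d.+1 L) = nth 0%N [:: 0; i1; i2; i3; i4]%N k.
  case: k => -[|[|[|[|[|//]]]]] /= k_lt; apply: heightE; rewrite /=.
  - by rewrite !mod0n.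
  - exact: h1.
  - exact: h2.
  - exact: h3.
  - exact: h4.
under eq_bigr do rewrite heights; rewrite deltaE !big_ord_recl big_ord0 /=.
by rewrite !coefD coef1 !coefXn !natz !(eq_sym n) addr0 -!addrA.
Qed.

Theorem theorem0p2 (R : realType) (d : nat) (delta : 'I_d.+1 -> int)
    (delta_ge0 : forall k, 0 <= delta k)
    (delta_0 : delta ord0 = 1)
    (delta_sum : \sum_(k < d.+1) delta k = 5)
    (i : nat -> nat)
    (i_bounds : [/\ 1 <= i 1, i 1 <= i 2, i 2 <= i 3, i 3 <= i 4 & i 4 <= d]%N)
    (delta_i : gen_poly delta
               = 1 + 'X^(i 1%N) + 'X^(i 2%N) + 'X^(i 3%N) + 'X^(i 4%N)) :
  (exists P : set 'rV[R]_d, integral_simplex d P /\ is_delta_vector P delta)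
  <->
  [/\ (i 1 + i 4 = i 2 + i 3)%N,
      (i 2 + i 3 <= d + 1)%N
    & forall k l : nat, (1 <= k)%N -> (k <= l)%N -> (l <= 4)%N ->
        (k + l <= 4)%N -> (i k + i l >= i (k + l))%N].
Proof.
case: i_bounds => i1_gt0 i12 i23 i34 i4d; split=> [[P [P_simplex P_delta]]|].
  have [i1423 i23d [i2_le i3_le i4_le i4_le']] :=
    delta_vector_inequalities delta_sum i12 i23 i34 delta_i P_simplex P_delta.
  split=> // k l k_gt0 kl _ kl4.
  have /orP[/andP[/eqP-> /or3P[]/eqP->]|/andP[/eqP-> /eqP->]] // :
    ((k == 1) && [|| l == 1, l == 2 | l == 3]
     || (k == 2) && (l == 2))%N by lia.
case=> i1423 i23d sub_add.
apply: (exists_simplex_of_inequalities R i1_gt0 i12 i23 i34 i4d delta_i i1423).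
- by rewrite i1423 -[d.+1]addn1.
- exact: sub_add 1%N 1%N isT isT isT isT.
- exact: sub_add 1%N 2%N isT isT isT isT.
Qed.
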